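(* For all integers $n\ge 2$, $k\ge 0$ and $0\le i\le 3$, $$t(n,k,i)\le 2^{0.119n+1.96k-1.4625i+4}.$$
   Context: For a tree $T$ on $n$ vertices, a linear arrangement is a bijection $\alpha:V(T)\to\{1,\dots,n\}$ with net cost $\sum_{uv\in E(T)}(|\alpha(u)-\alpha(v)|-1)$. For $X\subseteq V(T)$ and integer $k\ge 0$, $OLA^+_T(n,k,X)$ is the set of linear arrangements $\alpha$ of $T$ with net cost at most $k$ such that $\alpha(x)\in\{1,n\}$ for all $x\in X$. Let $\mathcal T_n$ be the set of trees on $n$ vertices and define $t(n,k,i)=\max\{|OLA^+_T(n,k,X)| : T\in\mathcal T_n,\ X\subseteq V(T),\ |X|=i\}$ (taken to be $0$ if no such pair exists). *)

(* Defs.v *)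
From mathcomp Require Import all_boot all_order all_algebra all_fingroup.
From mathcomp Require Import boolp.

Set Implicit Arguments.
Unset Strict Implicit.
Unset Printing Implicit Defensive.

(* A graph on the vertex set 'I_n is its set of ordered adjacent pairs, so that
   graphs form a finite type. *)
Definition graph (n : nat) := {set 'I_n * 'I_n}.

Definition adj (n : nat) (T : graph n) : rel 'I_n := fun u v => (u, v) \in T.

Definition is_tree (n : nat) (T : graph n) : Prop :=
  [/\ irreflexive (adj T), symmetric (adj T),
      forall u v, connect (adj T) u v
    & forall c : seq 'I_n, 2 < size c -> ~ ucycle (adj T) c].

(* A linear arrangement is a permutation of 'I_n; positions are shifted to run
   over 1, ..., n. *)
Definition pos (n : nat) (alpha : 'S_n) (v : 'I_n) : nat := (alpha v).+1.

(* Each edge is counted once, through its orientation u < v. The truncated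
   subtraction of 1 is exact since alpha is injective. *)
Definition net_cost (n : nat) (T : graph n) (alpha : 'S_n) : nat :=
  \sum_(u < n) \sum_(v < n | (u < v) && adj T u v)
    (`|pos alpha u - pos alpha v|%N - 1).

Definition OLAplus (n : nat) (T : graph n) (k : nat) (X : {set 'I_n}) :
    {set 'S_n} :=
  [set alpha : 'S_n | (net_cost T alpha <= k) &&
    [forall x in X, (pos alpha x == 1) || (pos alpha x == n)]].

(* \max over an empty range of naturals is 0. *)
Definition t (n k i : nat) : nat :=
  \max_(T : graph n | `[< is_tree T >])
    \max_(X : {set 'I_n} | #|X| == i) #|OLAplus T k X|.

(* Main.v *)
Require Import Defs.
From mathcomp Require Import all_boot all_order all_algebra all_fingroup.
From mathcomp Require Import zify lra.
From mathcomp Require Import boolp reals exp.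

(** Put x = 2^-1.96, y = 2^0.119, z = 2^-1.4625 and weigh every arrangement by x
    to the power of its net cost.  It suffices that the total weight W(T, X) of
    the arrangements that keep X at the ends is at most 16 z^|X| y^n.

    Only connectivity of T matters.  Let l be a vertex outside X whose removal
    leaves T connected, and q a neighbour of l.  Every arrangement of T arises by
    inserting l into one of T - l; an interior insertion at distance d from q
    costs at least d, because some edge crosses the insertion point, while an
    insertion at an end costs d - 1.  Summing the geometric series, the
    insertions multiply the weight by at most 10/11, or 15/11 if q is at an end,
    so W(T, X) <= 10/11 W(T-l, X) + 5/11 W(T-l, X+q), and
    10/11 + 5/11 z <= y closes the induction.

    If there is no such l, then X consists of the two ends of a Hamiltonian path
    v_1, ..., v_n.  Let A_n be the weight of the arrangements of the path with v_1
    first and v_n last, and E_n that of those with v_n last but v_1 not first.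
    A vertex inserted before its successor on the path is crossed by at least two
    edges, whence A_n <= A_(n-1) + x^2/(1-x^2) A_(n-2) + x^3 (1 + 1/(1-x^2)) E_(n-2)
    and E_n <= x/(1-x) A_(n-1) + (x+x^2)/(1-x) E_(n-1).  These give
    A_n <= y^(n-1) and E_n <= 11/20 y^(n-1). *)

Set Implicit Arguments.
Unset Strict Implicit.
Unset Printing Implicit Defensive.
Import Order.TTheory GRing.Theory Num.Theory.

(** * Arrangements as sequences *)

Section Arrangements.
Variables (V : eqType) (e : rel V).
Hypothesis e_sym : symmetric e.
Implicit Types (l q u v w : V) (s p X : seq V).

(* With [d = 0], the excess length of the edges from [w] into [s] in the
   arrangement [w :: s]; [back s l] does the same for [rcons s l]. *)
Fixpoint reach w s d := if s is v :: s' then e w v * d + reach w s' d.+1 else 0.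
Fixpoint net s := if s is w :: s' then reach w s' 0 + net s' else 0.
Fixpoint back s l := if s is a :: s' then e a l * size s' + back s' l else 0.
Definition cross s1 s2 := \sum_(u <- s1) count (e u) s2.
Definition ins l j s := take j s ++ l :: drop j s.

Lemma reachS w s d : reach w s d.+1 = reach w s d + count (e w) s.
Proof. by elim: s d => [|v s IH] d //=; rewrite IH; case: (e w v); lia. Qed.

Lemma reach_ins w s1 l s2 d :
  reach w (s1 ++ l :: s2) d =
  reach w (s1 ++ s2) d + e w l * (d + size s1) + count (e w) s2.
Proof.
elim: s1 d => [|v s1 IH] d /=; first by rewrite reachS; case: (e w l); lia.
by rewrite IH; case: (e w l); case: (e w v); lia.
Qed.

Lemma net_insert s1 l s2 :
  net (s1 ++ l :: s2) = net (s1 ++ s2) + cross s1 s2 + back s1 l + reach l s2 0.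
Proof.
rewrite /cross; elim: s1 => [|a s1 IH] /=; first by rewrite big_nil; lia.
by rewrite big_cons IH reach_ins; lia.
Qed.

Lemma reach_ge_index l q s d : e l q -> q \in s -> d + index q s <= reach l s d.
Proof.
move=> elq; elim: s d => //= v s IH d; rewrite in_cons eq_sym.
by case: eqVneq => [->|_] /=; [rewrite elq; lia | move=> /(IH d.+1); lia].
Qed.

Lemma back_ge_index l q s : e l q -> q \in s -> size s - (index q s).+1 <= back s l.
Proof.
rewrite e_sym => elq; elim: s => //= v s IH; rewrite in_cons eq_sym.
by case: eqVneq => [->|_] /=; [rewrite elq; lia | move=> /IH; lia].
Qed.

Lemma net_ins l q j s : e l q -> q \in s -> j <= size s ->
  net s + cross (take j s) (drop j s)
    + (if j <= index q s then index q s - j else j - (index q s).+1)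
  <= net (ins l j s).
Proof.
move=> elq qs js; rewrite /ins net_insert cat_take_drop.
have := index_cat q (take j s) (drop j s); rewrite cat_take_drop in_take //.
rewrite size_takel // [j <= _]leqNgt; case: ltnP => /= [lt_rj | le_jr] eqi.
  have qt : q \in take j s by rewrite in_take //.
  by have := back_ge_index elq qt; rewrite size_takel // -eqi; lia.
have qd : q \in drop j s.
  by have := qs; rewrite -{1}(cat_take_drop j s) mem_cat in_take // ltnNge le_jr.
by have := reach_ge_index 0 elq qd; lia.
Qed.

Lemma size_ins l j s : size (ins l j s) = (size s).+1.
Proof. by rewrite size_cat /= addnS -size_cat cat_take_drop. Qed.

Lemma index_ins l j s a : a != l -> a \in s -> j <= size s ->
  index a (ins l j s) = if index a s < j then index a s else (index a s).+1.
Proof.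
move=> al as_ js; rewrite /ins index_cat in_take //= eq_sym (negPf al).
have := index_cat a (take j s) (drop j s); rewrite cat_take_drop in_take //.
by rewrite size_takel //; case: ltnP => // _ ->; rewrite addnS.
Qed.

Lemma index_ins_self l j s : l \notin s -> j <= size s -> index l (ins l j s) = j.
Proof.
move=> ls js; rewrite /ins index_cat; case: ifP => [/mem_take|_].
  by rewrite (negPf ls).
by rewrite /= eqxx addn0 size_takel.
Qed.

Lemma perm_ins l j s : perm_eq (ins l j s) (l :: s).
Proof.
by rewrite /ins (perm_catCA _ [:: l] _) /= perm_cons cat_take_drop.
Qed.

Lemma rem_ins l j s : l \notin s -> rem l (ins l j s) = s.
Proof.
rewrite /ins => ls; rewrite -[RHS](cat_take_drop j).
have: l \notin take j s by apply: contra ls => /mem_take.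
elim: (take j s) => [|a s1 IH] /=; first by rewrite eqxx.
by rewrite in_cons negb_or eq_sym => /andP[/negPf-> /IH ->].
Qed.

Lemma permutations_cons l p : uniq (l :: p) ->
  perm_eq (permutations (l :: p))
    [seq ins l j s | s <- permutations p, j <- index_iota 0 (size p).+1].
Proof.
rewrite cons_uniq => /andP[lp up]; apply: uniq_perm; first exact: permutations_uniq.
  rewrite allpairs_uniq ?permutations_uniq ?iota_uniq //.
  move=> [s j] [s' j'] /allpairsP[[a1 a2] h] /allpairsP[[a1' a2'] h'].
  case: h h' => /= + + [-> ->] [+ + [-> ->]]; rewrite !mem_permutations.
  rewrite !mem_index_iota => pa ja pa' ja' eqi.
  have na : l \notin a1 by rewrite (perm_mem pa).
  have na' : l \notin a1' by rewrite (perm_mem pa').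
  have sz := perm_size pa; have sz' := perm_size pa'.
  congr (_, _); first by rewrite -(rem_ins a2 na) eqi rem_ins.
  by rewrite -(@index_ins_self l a2 a1) ?eqi ?index_ins_self //; lia.
move=> s; rewrite mem_permutations; apply/idP/allpairsP => [ps|]; last first.
  case=> -[s' j] /= [+ _ ->]; rewrite mem_permutations => ps.
  by apply: perm_trans (perm_ins _ _ _) _; rewrite perm_cons.
have ls : l \in s by rewrite (perm_mem ps) mem_head.
case/splitPr: {1 2}s / ls ps => s1 s2 ps.
have ps' : perm_eq (s1 ++ s2) p.
  by rewrite -(perm_cons l) -(perm_catCA s1 [:: l]) /=.
exists (s1 ++ s2, size s1); split=> /=; first by rewrite mem_permutations.
  by rewrite mem_index_iota; have := perm_size ps'; rewrite size_cat; lia.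
by rewrite /ins take_size_cat // drop_size_cat.
Qed.

Definition conn p := forall B : pred V,
  (exists2 u, u \in p & B u) -> (exists2 v, v \in p & ~~ B v) ->
  exists u v, [/\ u \in p, v \in p, B u, ~~ B v & e u v].

Lemma eq_conn p p' : p =i p' -> conn p -> conn p'.
Proof.
move=> eqp cp B [u up Bu] [v vp Bv].
have [||a [b [ap bp *]]] := cp B; [by exists u; rewrite ?eqp | by exists v;
  rewrite ?eqp|].
by exists a, b; split; rewrite -?eqp.
Qed.

Lemma conn1 v : conn [:: v].
Proof. by move=> B [u /[!inE] /eqP-> Bv] [w /[!inE] /eqP-> /negP]. Qed.

Lemma conn_cons v p : conn p -> has (e v) p -> conn (v :: p).
Proof.
move=> cp /hasP[w wp evw] B [a ap Ba] [b bp Bb].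
have wp' : w \in v :: p by rewrite in_cons wp orbT.
have [Bvw|Bvw] := eqVneq (B v) (B w); last first.
  case Bv: (B v) Bvw => /=; first by case Bw: (B w) => // _; exists v, w;
    rewrite mem_head Bw.
  by case Bw: (B w) => // _; exists w, v; rewrite mem_head Bv e_sym.
have [||c [d [cp' dp *]]] := cp B.
- by move: ap; rewrite in_cons => /orP[/eqP av|?]; [exists w;
    rewrite // -Bvw -av | exists a].
- by move: bp; rewrite in_cons => /orP[/eqP bv|?]; [exists w;
    rewrite // -Bvw -bv | exists b].
by exists c, d; split; rewrite // in_cons ?cp' ?dp orbT.
Qed.

Lemma conn_path v p : path e v p -> conn (v :: p).
Proof.
elim: p v => [|w p IH] v /=; first by move=> _; apply: conn1.
by case/andP=> evw pw; apply: conn_cons; [apply: IH | rewrite /= evw].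
Qed.

Lemma conn_noncut p S : uniq p -> conn p -> conn S -> uniq S -> {subset S <= p} ->
  S != [::] -> size S < size p ->
  exists l p', [/\ perm_eq p (l :: p'), conn p' & l \notin S].
Proof.
move=> up cp; move: {2}(size p - size S) (leqnn (size p - size S)) => k.
elim: k S => [|k IH] S; first by lia.
move=> lek cS uS sSp S0 ltS.
have [||u [v [uP vP uS' vS euv]]] := cp (mem S).
- by case: S S0 sSp {lek cS uS ltS} => // a S _ /(_ a (mem_head _ _)) ?;
    exists a => //; apply: mem_head.
- have /allPn[v] : ~~ all (mem S) p.
    by apply/negP=> /allP /(uniq_leq_size up); lia.
  by exists v.
have cvS : conn (v :: S).
  by apply: conn_cons => //; apply/hasP; exists u; rewrite // e_sym.
have uvS : uniq (v :: S) by rewrite /= vS.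
have svS : {subset v :: S <= p} by apply/allP; rewrite /= vP; apply/allP.
have [ltvS|gevS] := ltnP (size (v :: S)) (size p).
  have lek' : size p - size (v :: S) <= k by move: lek => /=; lia.
  have [l [p' [pp cp']]] := IH (v :: S) lek' cvS uvS svS isT ltvS.
  by rewrite in_cons negb_or => /andP[_ lS]; exists l, p'.
have [_ eqm] := uniq_min_size uvS svS gevS.
have pvS : perm_eq p (v :: S) by rewrite perm_sym uniq_perm.
by exists v, S.
Qed.

Lemma conn_cross p s1 s2 : conn p -> perm_eq (s1 ++ s2) p -> uniq p ->
  s1 != [::] -> s2 != [::] -> 0 < cross s1 s2.
Proof.
move=> cp ps up; rewrite -(perm_uniq ps) cat_uniq in up.
case/and3P: up => _ /hasPn d _ s10 s20.
have [a a1] : exists a, a \in s1 by case: s1 s10 {ps d} => // a s _; exists a;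
  apply: mem_head.
have [b b2] : exists b, b \in s2 by case: s2 s20 {ps d} => // b s _; exists b;
  apply: mem_head.
have [||u [v [uP vP uS vS euv]]] := cp (mem s1).
- by exists a; rewrite // -(perm_mem ps) mem_cat a1.
- by exists b; [rewrite -(perm_mem ps) mem_cat b2 orbT | apply: d].
rewrite /cross (big_rem u) //= addn_gt0 -has_count; apply/orP; left.
apply/hasP; exists v => //.
by move: vP; rewrite -(perm_mem ps) mem_cat; case/orP => // vs1;
  rewrite [mem _ _]vs1 in vS.
Qed.

Lemma path_switch (B : pred V) v p : path e v p -> B v -> ~~ B (last v p) ->
  exists c d, [/\ c \in v :: p, d \in p, e c d, B c & ~~ B d].
Proof.
elim: p v => [|w p IH] v /=; first by move=> _ ->.
case/andP=> evw pw Bv nB; have [Bw|Bw] := boolP (B w); last first.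
  by exists v, w; rewrite !mem_head.
have [c [d [cp dp *]]] := IH w pw Bw nB.
by exists c, d; split; rewrite // in_cons ?cp ?dp orbT.
Qed.

Lemma cross_ge2 s1 s2 a b c d : a \in s1 -> b \in s2 -> c \in s1 -> d \in s2 ->
  e a b -> e c d -> b != d -> 1 < cross s1 s2.
Proof.
move=> a1 b2 c1 d2 eab ecd bd; rewrite /cross (big_rem a) //=.
have gt0 (w v : V) : v \in s2 -> e w v -> 0 < count (e w) s2.
  by move=> v2 ewv; rewrite -has_count; apply/hasP; exists v.
have [eac|nac] := eqVneq a c.
  rewrite (leq_trans _ (leq_addr _ _)) //.
  have -> : 2 = size [:: b; d] by [].
  rewrite -size_filter; apply: uniq_leq_size; first by rewrite /= inE bd.
  by move=> v; rewrite !inE mem_filter => /orP[]/eqP->;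
    rewrite ?eab ?eac ?ecd ?b2 ?d2.
have cr : c \in rem a s1 by have := perm_mem (perm_to_rem a1) c;
  rewrite c1 in_cons eq_sym (negPf nac).
by rewrite (big_rem c) //=; have := gt0 _ _ b2 eab; have := gt0 _ _ d2 ecd; lia.
Qed.

Lemma path_cross v p s1 s2 : path e v p -> uniq (v :: p) ->
  perm_eq (s1 ++ s2) (v :: p) -> s1 != [::] -> v \in s2 -> last v p \in s2 ->
  1 < cross s1 s2.
Proof.
move=> pp up ps s10 vs2 ls2.
have d u : u \in s1 -> u \notin s2.
  have: uniq (s1 ++ s2) by rewrite (perm_uniq ps).
  by rewrite cat_uniq => /and3P[_ /hasPn d _] u1; apply: contraL u1 => /d.
have eqs u : u \in v :: p -> u \notin s1 -> u \in s2.
  by rewrite -(perm_mem ps) mem_cat => /orP[->|].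
case: s1 s10 ps d eqs => // u s1' _; set s1 := u :: s1' => ps d eqs.
have u1 : u \in s1 by apply: mem_head.
have up' : u \in p.
  have: u \in v :: p by rewrite -(perm_mem ps) mem_cat u1.
  by rewrite in_cons => /orP[/eqP uv|//]; move: (d _ u1); rewrite uv vs2.
case/path.splitP: up' pp up ls2 ps eqs => p1 p2.
rewrite cat_path last_cat last_rcons => /andP[pp1 pp2] up ls2 ps eqs.
have nu : ~~ mem s2 (last v (rcons p1 u)) by rewrite last_rcons; apply: d.
have nl : ~~ mem s1 (last u p2) by apply/negP => /d; rewrite ls2.
have [a [b [ap bp eab aB bB]]] := path_switch pp1 vs2 nu.
have [c [e' [cp dp ecd cB dB]]] := path_switch pp2 u1 nl.
have b1 : b \in s1.
  have b2 : b \notin s2 := bB.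
  by apply: contraR b2 => /eqs; apply; rewrite -cat_cons mem_cat in_cons bp orbT.
have e2 : e' \in s2 by apply: eqs dB; rewrite -cat_cons mem_cat dp orbT.
apply: (@cross_ge2 _ _ b a c e') => //; rewrite 1?e_sym //.
apply: contraTneq dp => <-; move: up; rewrite -cat_cons cat_uniq => /and3P[_ /hasPn
  h _].
by apply/negP=> /h /negP; apply.
Qed.

End Arrangements.

(** * Weights and the Hamiltonian path *)

Lemma take_neq_nil (T : eqType) (s : seq T) j : 0 < j < size s -> take j s != [::].
Proof. by case: s => [|a s]; case: j. Qed.

Lemma drop_neq_nil (T : eqType) (s : seq T) j : j < size s -> drop j s != [::].
Proof. by rewrite -size_eq0 size_drop subn_eq0 -ltnNge. Qed.

Section Weights.
Local Open Scope ring_scope.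
Variables (V : eqType) (e : rel V) (R : realFieldType) (x : R).
Hypothesis e_sym : symmetric e.
Hypotheses (x_ge0 : 0 <= x) (x_le1 : x <= 1).
Implicit Types (l q u v w : V) (s p X : seq V) (P : pred (seq V)).
Local Notation net := (net e).
Local Notation conn := (conn e).
Local Notation cross := (cross e).

Definition weight P p : R := \sum_(s <- permutations p | P s) x ^+ net s.

Lemma expx_le i j : (i <= j)%N -> x ^+ j <= x ^+ i.
Proof. by move=> ij; apply: ler_wiXn2l. Qed.

Lemma weight_ge0 P p : 0 <= weight P p.
Proof. by apply: sumr_ge0 => s _; apply: exprn_ge0. Qed.

Lemma sum_geo_le (c y : R) d : 0 <= y -> y < 1 -> 1 <= c * (1 - y) ->
  \sum_(t < d) y ^+ t <= c.
Proof.
move=> y0 y1 cy; have := subrX1 y d; have := exprn_ge0 d y0.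
move: (\sum_(t < d) _) (y ^+ d) => S E E0 eqS; nra.
Qed.

Lemma sum_around (F : nat -> R) m r : (r < m)%N ->
  \sum_(0 <= j < m.+1) F j =
  (\sum_(t < r) F (r - t)%N + F 0%N) + (\sum_(t < m.-1 - r) F (r.+1 + t)%N + F m).
Proof.
move=> rm; rewrite (big_cat_nat (n := r.+1)) //=; last by lia.
congr (_ + _).
  rewrite big_mkord (reindex_inj rev_ord_inj) big_ord_recr /= subSS subnn.
  by congr (_ + _); apply: eq_bigr => t _; rewrite subSS.
rewrite -{1}[r.+1]add0n big_addn (_ : (m.+1 - r.+1 = (m.-1 - r).+1)%N); last by lia.
rewrite big_mkord big_ord_recr /=; congr (_ + F _); last by lia.
by apply: eq_bigr => t _; rewrite addnC.
Qed.

Lemma sum_permutations_cons (F : seq V -> R) l p : uniq (l :: p) ->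
  \sum_(s <- permutations (l :: p)) F s =
  \sum_(s <- permutations p) \sum_(0 <= j < (size p).+1) F (ins l j s).
Proof.
by move=> ulp; rewrite (perm_big _ (permutations_cons ulp)) big_allpairs_dep.
Qed.

Lemma sum_ins_le P (wt : nat -> R) l q p s (k : nat) (bL bR : bool) :
  (forall j, 0 <= wt j) -> uniq p -> conn p -> perm_eq s p -> q \in p -> e l q ->
  (P (ins l 0 s) -> bL) -> (P (ins l (size p) s) -> bR) ->
  (forall j, (0 < j <= index q s)%N -> (k <= cross (take j s) (drop j s))%N) ->
  \sum_(0 <= j < (size p).+1) (if P (ins l j s) then wt j * x ^+ net (ins l j s)
    else 0)
  <= x ^+ net s *
     ((\sum_(t < index q s) wt (index q s - t)%N * x ^+ (t + k)
        + bL%:R * (wt 0%N * x ^+ index q s))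
    + (\sum_(t < (size p).-1 - index q s) wt ((index q s).+1 + t)%N * x ^+ t.+1
        + bR%:R * (wt (size p) * x ^+ ((size p).-1 - index q s)))).
Proof.
move=> wt0 up cp ps qp elq hL hR hk.
have sz := perm_size ps; have qs : q \in s by rewrite (perm_mem ps).
have rm : (index q s < size p)%N by rewrite -sz index_mem.
have bound j d : (j <= size p)%N ->
    (net s + d <= net (ins l j s))%N ->
    (if P (ins l j s) then wt j * x ^+ net (ins l j s) else 0)
      <= x ^+ net s * (wt j * x ^+ d).
  move=> jm hd; rewrite mulrCA -exprD.
  by case: ifP => _; rewrite ?ler_wpM2l ?expx_le ?mulr_ge0 ?exprn_ge0.
have boundb j d (b : bool) : (j <= size p)%N -> (P (ins l j s) -> b) ->
    (net s + d <= net (ins l j s))%N ->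
    (if P (ins l j s) then wt j * x ^+ net (ins l j s) else 0)
      <= x ^+ net s * (b%:R * (wt j * x ^+ d)).
  case: b => [jm _ hd|_ hP _]; first by rewrite mul1r bound.
  by case: ifP => [/hP|_] //; rewrite mul0r mulr0.
have crossP j : (0 < j < size p)%N -> (0 < cross (take j s) (drop j s))%N.
  move=> jm; apply: (conn_cross cp); rewrite ?cat_take_drop //.
    by apply: take_neq_nil; rewrite sz.
  by apply: drop_neq_nil; rewrite sz; case/andP: jm.
rewrite (sum_around _ rm) !mulrDr !mulr_sumr; do 2!apply: lerD.
- apply: ler_sum => t _; have lt := ltn_ord t; set j := (_ - t)%N.
  have jr : (0 < j <= index q s)%N by rewrite subn_gt0 lt leq_subr.
  have jm : (j <= size p)%N by case/andP: jr => _ /leq_trans; apply; apply: ltnW.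
  apply: bound => //; have := hk _ jr; have := net_ins e_sym elq qs (j := j).
  by rewrite sz jm; case/andP: jr => _ ->; rewrite /j; clear - lt; lia.
- apply: boundb => //; have := net_ins e_sym elq qs (leq0n _).
  by rewrite leq0n; clear; lia.
- apply: ler_sum => t _; have lt := ltn_ord t; set j := (_.+1 + t)%N.
  have jm : (0 < j < size p)%N by rewrite /j; clear - lt rm; lia.
  have jr : (j <= index q s)%N = false by rewrite /j; clear; lia.
  case/andP: (jm) => _ /ltnW jm'.
  apply: bound => //; have := crossP _ jm; have := net_ins e_sym elq qs (j := j).
  by rewrite sz jm' jr /j; clear; lia.
- have jr : (size p <= index q s)%N = false by clear - rm; lia.
  apply: boundb => //; have := net_ins e_sym elq qs (j := size p).
  by rewrite sz leqnn jr; clear - rm; lia.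
Qed.

Definition first_at v s := index v s == 0%N.
Definition last_at v s := (index v s).+1 == size s.

Definition path_fixed v p := weight (fun s => first_at v s && last_at (last v p) s)
  (v :: p).
Definition path_free v p := weight (fun s => ~~ first_at v s && last_at (last v p)
  s) (v :: p).

Lemma last_at_ins l j s a : a != l -> a \in s -> (j <= size s)%N ->
  last_at a (ins l j s) = last_at a s && (j < size s)%N.
Proof.
move=> al as_ js; rewrite /last_at size_ins index_ins //.
by have := index_mem a s; rewrite as_; case: ifP; lia.
Qed.

Lemma first_at_ins l j s a : a != l -> a \in s -> (j <= size s)%N ->
  first_at a (ins l j s) = first_at a s && (0 < j)%N.
Proof. by move=> al as_ js; rewrite /first_at index_ins //; case: ifP; lia. Qed.

Lemma path_cross_before v p s j : path e v p -> uniq (v :: p) ->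
  perm_eq s (v :: p) -> last_at (last v p) s -> (0 < j <= index v s)%N ->
  (1 < cross (take j s) (drop j s))%N.
Proof.
move=> pp up ps /eqP la jr.
have sz := perm_size ps; have vs : v \in s by rewrite (perm_mem ps) mem_head.
have ls : last v p \in s by rewrite (perm_mem ps) mem_last.
have drp a : a \in s -> (j <= index a s)%N -> a \in drop j s.
  move=> as_ ja; have := as_; rewrite -{1}(cat_take_drop j s) mem_cat in_take //.
  by rewrite ltnNge ja.
have vm : (index v s < size s)%N by rewrite index_mem.
apply: (path_cross e_sym pp up); rewrite ?cat_take_drop //.
- by apply: take_neq_nil; lia.
- by apply: drp => //; lia.
- by apply: drp => //; lia.
Qed.

Lemma weight_splitl P Q p :
  weight P p = weight (fun s => Q s && P s) p + weight (fun s => ~~ Q s && P s) p.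
Proof. by rewrite /weight (bigID Q) /=; congr (_ + _); apply: eq_bigl => s;
  rewrite andbC. Qed.

Lemma weight_mkcond P p :
  weight P p = \sum_(s <- permutations p) (if P s then x ^+ net s else 0).
Proof. exact: big_mkcond. Qed.

Lemma ler_sum_permutations (F G : seq V -> R) p :
  (forall s, perm_eq s p -> F s <= G s) ->
  \sum_(s <- permutations p) F s <= \sum_(s <- permutations p) G s.
Proof.
move=> FG; rewrite big_seq [leRHS]big_seq; apply: ler_sum => s.
by rewrite mem_permutations; apply: FG.
Qed.

Lemma sum_if_le P (G : seq V -> R) (c d : R) Q p :
  (forall s, perm_eq s p -> G s <=
    if P s then x ^+ net s * (if Q s then c else d) else 0) ->
  \sum_(s <- permutations p) G s <=
  c * weight (fun s => Q s && P s) p + d * weight (fun s => ~~ Q s && P s) p.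
Proof.
move=> hG; rewrite !weight_mkcond !mulr_sumr -big_split /=.
apply: ler_sum_permutations => s /hG /le_trans; apply.
by case: (P s); case: (Q s); rewrite /= ?mulr0 ?addr0 ?add0r ?[x ^+ _ * _]mulrC
  ?lexx.
Qed.

Lemma path_free_rec (c : R) v w p : x < 1 -> 1 <= c * (1 - x) ->
  path e v (w :: p) -> uniq (v :: w :: p) ->
  path_free v (w :: p) <=
  x * c * path_fixed w p + (x ^+ 2 * c + x * c) * path_free w p.
Proof.
move=> x1 hc /= /andP[evw pw] /andP[vp up]; rewrite /path_free [leLHS]weight_mkcond.
rewrite sum_permutations_cons /= ?vp //.
apply: (@sum_if_le (last_at (last w p))) => s ps; rewrite -/(size (w :: p)).
have sz := perm_size ps; set L := last w p.
have Lp : L \in w :: p by apply: mem_last.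
have Ls : L \in s by rewrite (perm_mem ps).
have vs : v \notin s by rewrite (perm_mem ps).
have Lv : L != v by apply: contraNneq vp => <-.
have [la|nla] := boolP (last_at L s); last first.
  rewrite big_nat big1 // => j jm.
  by rewrite last_at_ins ?sz // (negPf nla) andbF.
have geo d k : \sum_(t < d) 1 * x ^+ (t + k) <= x ^+ k * c.
  under eq_bigr => t _ do rewrite mul1r exprD mulrC.
  by rewrite -mulr_sumr ler_wpM2l ?exprn_ge0 // sum_geo_le.
have hL : ~~ first_at v (ins v 0 s) && last_at L (ins v 0 s) -> false.
  by rewrite /first_at index_ins_self.
have hR : ~~ first_at v (ins v (size (w :: p)) s) && last_at L (ins v (size (w ::
  p)) s) -> false.
  by rewrite last_at_ins -?sz // ltnn !andbF.
have := @sum_ins_le (fun s => ~~ first_at v s && last_at L s) (fun=> 1) v w (w ::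
  p) s 2 _ _
  (fun=> ler01) up (conn_path e_sym pw) ps (mem_head _ _) evw hL hR
  (fun j => path_cross_before pw up ps la).
rewrite [X in X <= _ -> _](eq_bigr (fun j =>
  if ~~ first_at v (ins v j s) && last_at L (ins v j s)
  then x ^+ net (ins v j s) else 0)); last by move=> j _; rewrite mul1r.
move/le_trans; apply; rewrite ler_wpM2l ?exprn_ge0 // !mul0r !addr0.
under [X in _ + X]eq_bigr => t _ do rewrite -addn1.
have := geo (index w s) 2%N; have := geo ((size (w :: p)).-1 - index w s)%N 1%N.
rewrite expr1 /first_at; move: (\sum_(t < _.-1 - _) _) => S.
case: eqP => [-> | _]; last by move=> *; rewrite lerD.
by rewrite big_ord0 add0r.
Qed.

Lemma mul_natX_le1 r : x <= 2^-1 -> r.+1%:R * x ^+ r <= 1.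
Proof.
move=> x2; elim: r => [|r IH]; first by rewrite mulr1.
have E0 := exprn_ge0 r x_ge0; rewrite exprS.
have r0 : (0 : R) <= r%:R by apply: ler0n.
move: IH; rewrite -!natr1; move: (x ^+ r) (r%:R : R) E0 r0 => E a E0 a0 IH.
have h1 : (a + 1 + 1) * (x * E) <= (a + 1 + 1) * (2^-1 * E).
  by rewrite ler_wpM2l ?ler_wpM2r //; lra.
by apply: le_trans h1 _; nra.
Qed.

Lemma path_fixed_le_free_reach v w p : path e v (w :: p) -> uniq (v :: w :: p) ->
  path_fixed v (w :: p) <=
  path_fixed w p + \sum_(s <- permutations (w :: p))
    (if ~~ first_at w s && last_at (last w p) s then x ^+ index w s * x ^+ net s
      else 0).
Proof.
move=> /= /andP[evw pw] /andP[vp up]; rewrite /path_fixed weight_mkcond.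
rewrite sum_permutations_cons /= ?vp // weight_mkcond -big_split /=.
apply: ler_sum_permutations => s ps; set L := last w p.
have sz := perm_size ps.
have Lp : L \in w :: p by apply: mem_last.
have Ls : L \in s by rewrite (perm_mem ps).
have ws : w \in s by rewrite (perm_mem ps) mem_head.
have vs : v \notin s by rewrite (perm_mem ps).
have Lv : L != v by apply: contraNneq vp => <-.
rewrite big_nat_recl //= [X in _ + X]big_nat [X in _ + X]big1 ?addr0; last first.
  by move=> j jm; rewrite /first_at index_ins_self // sz.
rewrite last_at_ins // sz /= andbT; case: (last_at L s);
  last by rewrite !andbF addr0.
rewrite !andbT /first_at index_ins_self //=.
have := net_ins e_sym evw ws (leq0n _); rewrite leq0n subn0 => hn.
apply: (@le_trans _ _ (x ^+ index w s * x ^+ net s)).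
  by rewrite -exprD expx_le //; move: hn; clear; lia.
by case: eqP => [->|_]; rewrite /= ?mul1r ?addr0 ?add0r.
Qed.

Lemma path_fixed_rec (c : R) v w u p : x <= 2^-1 -> 1 <= c * (1 - x ^+ 2) ->
  path e v (w :: u :: p) -> uniq (v :: w :: u :: p) ->
  path_fixed v (w :: u :: p) <= path_fixed w (u :: p) +
    (x ^+ 2 * c * path_fixed u p + x ^+ 3 * (1 + c) * path_free u p).
Proof.
move=> x2 hc pv uv; apply: le_trans (path_fixed_le_free_reach pv uv) _.
rewrite lerD2l; move: pv uv => /= /and3P[_ ewu pu] /and3P[_ wp up].
rewrite sum_permutations_cons /= ?wp //.
apply: (@sum_if_le (last_at (last u p))) => s ps; rewrite -/(size (u :: p)).
have sz := perm_size ps; set L := last u p.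
have Lp : L \in u :: p by apply: mem_last.
have Ls : L \in s by rewrite (perm_mem ps).
have ws : w \notin s by rewrite (perm_mem ps).
have Lw : L != w by apply: contraNneq wp => <-.
have [la|nla] := boolP (last_at L s); last first.
  rewrite big_nat big1 // => j jm.
  by rewrite last_at_ins ?sz // (negPf nla) andbF.
have hL : ~~ first_at w (ins w 0 s) && last_at L (ins w 0 s) -> false.
  by rewrite /first_at index_ins_self.
have hR : ~~ first_at w (ins w (size (u :: p)) s) && last_at L (ins w (size (u ::
  p)) s) -> false.
  by rewrite last_at_ins -?sz // ltnn !andbF.
have := @sum_ins_le (fun s => ~~ first_at w s && last_at L s) (fun j => x ^+ j) w u
  (u :: p) s 2 _ _
  (fun j => exprn_ge0 j x_ge0) up (conn_path e_sym pu) ps (mem_head _ _) ewu hL hR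
  (fun j => path_cross_before pu up ps la).
cbv beta; rewrite [X in X <= _ -> _]big_nat [X in X <= _ -> _](_ : _ = \sum_(0 <= j
  < (size (u :: p)).+1)
  (if ~~ first_at w (ins w j s) && last_at L (ins w j s)
   then x ^+ index w (ins w j s) * x ^+ net (ins w j s) else 0)); last first.
  by rewrite [RHS]big_nat; apply: eq_bigr => j jm; rewrite index_ins_self ?sz.
move/le_trans; apply; rewrite ler_wpM2l ?exprn_ge0 // !mul0r !addr0.
rewrite /first_at; move: (index u s) => r; move: (_ - r)%N => d.
have -> : \sum_(t < r) x ^+ (r - t) * x ^+ (t + 2) = r%:R * x ^+ (r + 2).
  rewrite (eq_bigr (fun=> x ^+ (r + 2))).
    by rewrite sumr_const card_ord mulr_natl.
  by move=> t _; rewrite -exprD; congr (_ ^+ _); have := ltn_ord t; clear; lia.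
have -> : \sum_(t < d) x ^+ (r.+1 + t) * x ^+ t.+1 = x ^+ (r + 2) * \sum_(t < d) (x
  ^+ 2) ^+ t.
  rewrite mulr_sumr; apply: eq_bigr => t _; rewrite -exprM -!exprD.
  by congr (_ ^+ _); clear; lia.
have Sc : \sum_(t < d) (x ^+ 2) ^+ t <= c.
  by apply: sum_geo_le => //; [apply: exprn_ge0 | move: x_ge0 x2 => ? ?; nra].
have S0 : 0 <= \sum_(t < d) (x ^+ 2) ^+ t.
  by apply: sumr_ge0 => t _; rewrite !exprn_ge0.
move: (\sum_(t < d) _) S0 Sc => S S0 Sc.
case: r => [|r] /=; first by rewrite mul0r !add0r ler_wpM2l ?exprn_ge0.
have E1 : x ^+ r <= 1 by rewrite exprn_ile1.
have -> : x ^+ (r.+1 + 2) = x ^+ 3 * x ^+ r by rewrite -exprD; congr (_ ^+ _);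
  clear; lia.
rewrite mulrCA -mulrA -mulrDr ler_wpM2l ?exprn_ge0 // lerD ?mul_natX_le1 //.
by rewrite (le_trans _ Sc) // ler_piMl.
Qed.

Lemma path_fixed1 v : path_fixed v [::] = 1.
Proof.
by rewrite /path_fixed /weight /permutations /= big_cons big_nil /first_at /last_at
  /= eqxx addr0.
Qed.

Lemma path_free1 v : path_free v [::] = 0.
Proof. by rewrite /path_free /weight /permutations /= big_cons big_nil /first_at /=
  eqxx. Qed.

Lemma expr2_le : x <= 9 / 35 -> x ^+ 2 <= 1 / 15.
Proof.
move=> xle; apply: (@le_trans _ _ ((9 / 35) ^+ 2)); last by lra.
by rewrite lerXn2r // nnegrE; lra.
Qed.

Lemma path_weights (y : R) v p : x <= 9 / 35 -> 64 / 59 <= y ->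
  path e v p -> uniq (v :: p) ->
  path_fixed v p <= y ^+ (size p) /\ path_free v p <= 11 / 20 * y ^+ (size p).
Proof.
move=> xle yge.
have y0 : 0 <= y by lra.
have x2 : x <= 2^-1 by lra.
have x1 : x < 1 by lra.
have x0 := x_ge0.
have hc1 : 1 <= 35 / 26 * (1 - x) by lra.
have X2 := exprn_ge0 2 x0; have X3 := exprn_ge0 3 x0.
have hx2 := expr2_le xle.
have hx3 : x ^+ 3 <= 3 / 175.
  have : x * x ^+ 2 <= 9 / 35 * (1 / 15) by rewrite ler_pM.
  by rewrite -exprS; lra.
have hc2 : 1 <= 15 / 14 * (1 - x ^+ 2) by lra.
have A0 a r : 0 <= path_fixed a r by apply: weight_ge0.
have E0 a r : 0 <= path_free a r by apply: weight_ge0.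
have [k] := ubnP (size p); elim: k v p => // k IH v [|w p] szp pv uv.
  by rewrite path_fixed1 path_free1 expr0; split; lra.
have /andP[_ uw] := uv; have /andP[_ pw] := pv.
have [Aw Ew] := IH w p szp pw uw.
have Yp := exprn_ge0 (size p) y0.
have yY : 64 / 59 * y ^+ size p <= y * y ^+ size p by rewrite ler_wpM2r.
split; last first.
  apply: le_trans (path_free_rec x1 hc1 pv uv) _; rewrite /= [y ^+ _]exprS.
  have : x * (35 / 26) * path_fixed w p <= 9 / 26 * y ^+ size p.
    by apply: ler_pM (A0 _ _) _ Aw; lra.
  have : (x ^+ 2 * (35 / 26) + x * (35 / 26)) * path_free w p
      <= 34 / 78 * (11 / 20 * y ^+ size p).
    by apply: ler_pM (E0 _ _) _ Ew; lra.
  by lra.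
case: p szp pv uv uw pw Aw Ew Yp yY => [|u p] szp pv uv uw pw Aw Ew Yp yY.
  apply: le_trans (path_fixed_le_free_reach pv uv) _.
  rewrite path_fixed1 /permutations /= big_cons big_nil /first_at /= eqxx /= expr1;
    lra.
have /andP[_ uu] := uw; have /andP[_ pu] := pw.
have [Au Eu] := IH u p (ltnW szp) pu uu.
have Yu := exprn_ge0 (size p) y0.
apply: le_trans (path_fixed_rec x2 hc2 pv uv) _.
have : x ^+ 2 * (15 / 14) * path_fixed u p <= 1 / 14 * y ^+ size p.
  by apply: ler_pM (A0 _ _) _ Au; lra.
have : x ^+ 3 * (1 + 15 / 14) * path_free u p <= 3 / 175 * (29 / 14) * (11 / 20 * y
  ^+ size p).
  by apply: ler_pM (E0 _ _) _ Eu; lra.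
move: Aw yY; rewrite /= ![y ^+ _.+1]exprS.
have : 64 / 59 * (5 / 59) * y ^+ size p <= (y * (y - 1)) * y ^+ size p.
  by rewrite ler_wpM2r // ler_pM //; lra.
by lra.
Qed.

(** * Arrangements with prescribed end vertices *)

Definition ends X s := all (fun a => first_at a s || last_at a s) X.
(* Weight of the insertions on one side of [q] when [d] vertices lie on that
   side; [b] tells whether the extreme position, which no edge crosses, is
   allowed. *)
Definition tail (b : bool) d : R := \sum_(t < d) x ^+ t.+1 + b%:R * x ^+ d.

Lemma ends_ins X l j s : l \notin X -> {subset X <= s} -> (j <= size s)%N ->
  ends X (ins l j s) = all (fun a => first_at a s && (0 < j)%N || last_at a s && (j
    < size s)%N) X.
Proof.
move=> lX Xs js; apply: eq_in_all => a aX.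
have al : a != l by apply: contraNneq lX => <-.
by rewrite first_at_ins ?last_at_ins ?Xs.
Qed.

Lemma weight_ends_ins (c0 c1 : R) X l q p : uniq (l :: p) -> conn p -> q \in p -> e
  l q ->
  l \notin X -> {subset X <= p} ->
  (forall s, perm_eq s p -> ends X s ->
    tail (all (fun a => last_at a s) X) (index q s) +
    tail (all (fun a => first_at a s) X) ((size p).-1 - index q s)
      <= if first_at q s || last_at q s then c0 + c1 else c0) ->
  weight (ends X) (l :: p) <= c0 * weight (ends X) p + c1 * weight (ends (q :: X))
    p.
Proof.
move=> ulp cp qp elq lX Xp hc; have /andP[lp up] := ulp.
pose Q s := first_at q s || last_at q s.
rewrite (weight_splitl (ends X) Q p) mulrDr addrAC.
rewrite -[weight (ends (q :: X)) p]/(weight (fun s => Q s && ends X s) p) -mulrDl.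
rewrite [leLHS]weight_mkcond sum_permutations_cons //.
apply: sum_if_le => s ps; have sz := perm_size ps.
have Xs : {subset X <= s} by move=> a /Xp; rewrite (perm_mem ps).
have [eX|neX] := boolP (ends X s); last first.
  rewrite big_nat big1 // => j jm; rewrite ifF // ends_ins ?sz //.
  apply: contraNF neX; apply: sub_all => a.
  by case: (first_at a s) => //; case: (last_at a s); rewrite ?andbF.
have hL : ends X (ins l 0 s) -> all (fun a => last_at a s) X.
  rewrite ends_ins //; apply: sub_all => a.
  by rewrite andbF; case/andP.
have hR : ends X (ins l (size p) s) -> all (fun a => first_at a s) X.
  rewrite ends_ins ?sz //; apply: sub_all => a.
  by rewrite ltnn andbF orbF; case/andP.
have qs : q \in s by rewrite (perm_mem ps).
have cross1 j : (0 < j <= index q s)%N -> (1 <= cross (take j s) (drop j s))%N.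
  case/andP => j0 jr; have js : (j < size s)%N by rewrite (leq_ltn_trans jr)
    ?index_mem.
  apply: (conn_cross cp); rewrite ?cat_take_drop ?take_neq_nil ?drop_neq_nil //.
  by rewrite j0.
have := sum_ins_le (fun=> ler01) up cp ps qp elq hL hR cross1.
rewrite [X in X <= _ -> _](eq_bigr (fun j =>
  if ends X (ins l j s) then x ^+ net (ins l j s) else 0)); last by move=> j _;
    rewrite mul1r.
move/le_trans; apply; rewrite ler_wpM2l ?exprn_ge0 //.
apply: le_trans (hc s ps eX); rewrite /tail !mul1r.
rewrite le_eqVlt; apply/orP; left; apply/eqP; congr (_ + _ + (_ + _)).
  by apply: eq_bigr => t _; rewrite addn1 mul1r.
by apply: eq_bigr => t _; rewrite mul1r.
Qed.

Section Tails.
Hypothesis x_le : x <= 9 / 35.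

Lemma tailS b d : tail b d.+1 <= tail b d + (~~ b)%:R * x ^+ d.+1.
Proof.
rewrite /tail big_ord_recr /= -!addrA lerD2l exprS.
move: x_le (exprn_ge0 d x_ge0); move: (x ^+ d) => E xl E0.
by case: b => /=; move: x_ge0 => ?; rewrite ?mul1r ?mul0r; nra.
Qed.

Lemma tail_anti d d' : (d <= d')%N -> tail true d' <= tail true d.
Proof.
move/subnK <-; elim: (d' - d)%N => // k; apply: le_trans.
by have := tailS true (k + d); rewrite mul0r addr0.
Qed.

Lemma tail_le_true b d : tail b d <= tail true d.
Proof. by rewrite lerD2l; case: b => //; rewrite mul0r mul1r exprn_ge0. Qed.

Lemma tail0 b : tail b 0 = b%:R.
Proof. by rewrite /tail big_ord0 add0r mulr1. Qed.

Lemma tail_le1 b d : tail b d <= 1.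
Proof.
by apply: le_trans (tail_le_true b d) _; apply: le_trans (tail_anti (leq0n d)) _;
  rewrite tail0.
Qed.

Lemma tail_false d : tail false d <= 9 / 26.
Proof.
rewrite /tail mul0r addr0; under eq_bigr do rewrite exprS; rewrite -mulr_sumr.
have x0 := x_ge0; have xl := x_le.
have -> : (9 / 26 : R) = 9 / 35 * (35 / 26) by lra.
apply: ler_pM => //; first by apply: sumr_ge0 => t _; apply: exprn_ge0.
by apply: sum_geo_le => //; lra.
Qed.

Lemma tail1 b d : (0 < d)%N -> tail b d <= 18 / 35.
Proof.
move=> d0; apply: le_trans (tail_le_true b d) _; apply: le_trans (tail_anti d0) _.
by rewrite /tail big_ord1 /= !expr1; move: x_le => ?; lra.
Qed.

Lemma tail2 b d : (1 < d)%N -> tail b d <= 41 / 105.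
Proof.
move=> d0; apply: le_trans (tail_le_true b d) _; apply: le_trans (tail_anti d0) _.
rewrite /tail big_ord_recr big_ord1 /= mul1r expr1.
by move: x_le (expr2_le x_le); move: (x ^+ 2) => E *; lra.
Qed.

Lemma tail3 b d : (2 < d)%N -> tail b d <= 4 / 11.
Proof.
move=> d0; apply: le_trans (tail_le_true b d) _; apply: le_trans (tail_anti d0) _.
rewrite /tail !big_ord_recr big_ord0 /= add0r mul1r expr1.
have : x * x ^+ 2 <= 9 / 35 * (1 / 15) by rewrite ler_pM ?exprn_ge0 ?(expr2_le
  x_le) //.
by rewrite -exprS; move: x_le (expr2_le x_le); move: (x ^+ 2) (x ^+ 3) => E F *;
  lra.
Qed.

Lemma tail_sum_both m r : (3 < m)%N -> (r < m)%N ->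
  tail true r + tail true (m.-1 - r)
    <= if (r == 0%N) || (r.+1 == m) then 15 / 11 else 10 / 11.
Proof.
move=> m3 rm.
have [r0|r0] := posnP r.
  have d2 : (2 < m.-1 - r)%N by move: m3; rewrite r0; clear; lia.
  by have := tail3 true d2; have := tail_le1 true r; rewrite /=; lra.
have [d0|d0] := posnP (m.-1 - r).
  have r2 : (2 < r)%N by move: m3 rm d0; clear; lia.
  have -> : r.+1 == m by apply/eqP; move: rm d0; clear; lia.
  by have := tail3 true r2; have := tail_le1 true (m.-1 - r); rewrite /=; lra.
rewrite ifF; last by apply/eqP; move: r0 d0; clear; lia.
have [r1|r1] := ltnP 1 r.
  by have := tail2 true r1; have := tail1 true d0; lra.
have d1 : (1 < m.-1 - r)%N by move: m3 r1; clear; lia.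
by have := tail1 true r0; have := tail2 true d1; lra.
Qed.

Lemma tail_sum_one d d' :
  tail false d + tail true d' <= if d' == 0%N then 15 / 11 else 10 / 11.
Proof.
have hd := tail_false d; case: posnP => [_|d0].
  by have := tail_le1 true d'; lra.
by have := tail1 true d0; lra.
Qed.

Lemma weight_ends_free X l q p : uniq (l :: p) -> conn p -> q \in p -> e l q ->
  l \notin X -> {subset X <= p} -> uniq X -> q \notin X -> (1 < size p)%N ->
  (X = [::] -> (3 < size p)%N) ->
  weight (ends X) (l :: p) <=
  10 / 11 * weight (ends X) p + 5 / 11 * weight (ends (q :: X)) p.
Proof.
move=> ulp cp qp elq lX Xp uX qX p1 X0.
apply: weight_ends_ins => // s ps eX; have sz := perm_size ps.
have -> : (10 / 11 + 5 / 11 : R) = 15 / 11 by lra.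
have qs : q \in s by rewrite (perm_mem ps).
have rm : (index q s < size p)%N by rewrite -sz index_mem.
have neq a : a \in X -> index a s <> index q s.
  move=> aX eqi; have as_ : a \in s by rewrite (perm_mem ps) Xp.
  by move: qX; rewrite -(nth_index q qs) -eqi nth_index // aX.
case: X uX X0 lX Xp qX eX neq => [|a [|a' X]] uX X0 lX Xp qX eX neq.
- have {X0} p3 := X0 erefl; rewrite /first_at /last_at sz /=; exact: tail_sum_both.
- have nq := neq a (mem_head _ _).
  move: eX; rewrite /ends /= !andbT /first_at /last_at sz.
  move: (index a s) (index q s) nq rm => i r nq rm.
  case/orP => /eqP ia.
  + have -> : (i.+1 == size p) = false by rewrite ia ltn_eqF.
    have -> : (r == 0%N) || (r.+1 == size p) = ((size p).-1 - r == 0)%N.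
      by move: rm nq ia; clear; lia.
    by rewrite ia eqxx tail_sum_one.
  + have -> : (i == 0%N) = false by move: p1 ia; clear; lia.
    have -> : (r == 0%N) || (r.+1 == size p) = (r == 0)%N.
      by move: rm nq ia; clear; lia.
    by rewrite ia eqxx addrC tail_sum_one.
- have aa' : index a s <> index a' s.
    have as_ : a \in s by rewrite (perm_mem ps) Xp ?mem_head.
    have as' : a' \in s by rewrite (perm_mem ps) Xp // !inE eqxx orbT.
    move=> eqi; move: uX; rewrite /= -(nth_index q as_) eqi nth_index //.
    by rewrite mem_head.
  have -> : all (fun a => last_at a s) [:: a, a' & X] = false.
    by apply/negP => /= /and3P[/eqP h1 /eqP h2 _]; apply: aa'; apply: succn_inj;
      rewrite h1 h2.
  have -> : all (fun a => first_at a s) [:: a, a' & X] = false.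
    by apply/negP => /= /and3P[/eqP h1 /eqP h2 _]; apply: aa'; rewrite h1 h2.
  have := tail_false (index q s); have := tail_false ((size p).-1 - index q s).
  by case: ifP => _; lra.
Qed.

Lemma weight_ends_fixed X l q p : uniq (l :: p) -> conn p -> q \in p -> e l q ->
  l \notin X -> {subset X <= p} -> q \in X -> (1 < size p)%N ->
  weight (ends X) (l :: p) <= 10 / 11 * weight (ends X) p.
Proof.
move=> ulp cp qp elq lX Xp qX p1.
rewrite -[leRHS]addr0 -(mul0r (weight (ends (q :: X)) p)).
apply: weight_ends_ins => // s ps eX; have sz := perm_size ps.
rewrite addr0 if_same.
have /orP[/eqP r0|/eqP rm] := allP eX _ qX.
  have -> : all (fun a => last_at a s) X = false.
    by apply/negP => /allP/(_ _ qX); rewrite /last_at r0 sz ltn_eqF.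
  have d0 : (0 < (size p).-1 - index q s)%N by move: p1; rewrite r0; clear; lia.
  by have := tail1 (all (fun a => first_at a s) X) d0; rewrite r0 tail0 mulr0n; lra.
have -> : all (fun a => first_at a s) X = false.
  apply/negP => /allP/(_ _ qX); rewrite /first_at.
  by move: rm; rewrite sz; move: p1; clear; lia.
have d0 : ((size p).-1 - index q s = 0)%N by move: rm; rewrite sz; clear; lia.
have r0 : (0 < index q s)%N by move: rm; rewrite sz; move: p1; clear; lia.
by have := tail1 (all (fun a => last_at a s) X) r0; rewrite d0 tail0 mulr0n; lra.
Qed.

Lemma weight_ends_ins_le2 X l q p : uniq (l :: p) -> conn p -> q \in p -> e l q ->
  l \notin X -> {subset X <= p} -> weight (ends X) (l :: p) <= 2 * weight (ends X)
    p.
Proof.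
move=> ulp cp qp elq lX Xp.
rewrite -[leRHS]addr0 -(mul0r (weight (ends (q :: X)) p)).
apply: weight_ends_ins => // s ps eX; rewrite addr0 if_same.
have := tail_le1 (all (fun a => last_at a s) X) (index q s).
by have := tail_le1 (all (fun a => first_at a s) X) ((size p).-1 - index q s)%N;
  lra.
Qed.

End Tails.

End Weights.

Section Bound.
Variables (V : finType) (e : rel V).
Hypothesis e_sym : symmetric e.
Implicit Types (l q u v w : V) (s p X : seq V).

Lemma conn_neighbor l p : conn e (l :: p) -> l \notin p -> p != [::] ->
  exists2 q, q \in p & e l q.
Proof.
move=> cp lp p0; have [||u [v [up vp /eqP-> vl elv]]] := cp (pred1 l).
- by exists l; rewrite ?mem_head //= eqxx.
- case: p p0 lp {cp} => // a p _ lp; exists a; first by rewrite !inE eqxx orbT.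
  by apply: contraNneq lp => ->; rewrite mem_head.
by exists v => //; move: vp; rewrite in_cons (negPf (vl : v != l)).
Qed.

Lemma conn_upath p u v : conn e p -> u \in p -> v \in p ->
  exists p', [/\ path e u p', last u p' = v, uniq (u :: p') & {subset u :: p' <=
    p}].
Proof.
move=> cp up vp; pose eP := [rel a b | e a b && (b \in p)].
have : connect eP u v.
  apply: contraT => nuv; have [||a [b [ap bp ua ub eab]]] := cp (connect eP u).
  - by exists u => //; apply: connect0.
  - by exists v.
  by case/negP: ub; apply: (connect_trans ua); apply: connect1; rewrite /= eab.
case/connectP => p0 pp0 ->; case/shortenP: pp0 => p1 pp1 up1 _.
exists p1; split=> //; first by apply: sub_path pp1 => a b /andP[].
move=> a; rewrite in_cons => /orP[/eqP->//|].
elim: p1 {up1} u {up} pp1 => // b p1 IH u /= /andP[/andP[_ bp] pp1].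
by rewrite in_cons => /orP[/eqP->//|]; apply: IH pp1.
Qed.

Lemma noncut_or_path p X : uniq p -> conn e p -> 1 < size p -> size X <= 2 ->
  (exists l p', [/\ perm_eq p (l :: p'), conn e p' & l \notin X]) \/
  (exists v p', [/\ path e v p', perm_eq p (v :: p'), v \in X, last v p' \in X
                  & v != last v p']).
Proof.
move=> up cp p1 X2.
have sub1 v : v \in p -> {subset [:: v] <= p} by move=> vp a; rewrite inE => /eqP->.
have [v vp] : exists v, v \in p by case: p p1 {up cp sub1} => // v p _; exists v;
  apply: mem_head.
have [l [pl [ppl cl _]]] := conn_noncut e_sym up cp (@conn1 _ e v) isT (sub1 _ vp)
  isT p1.
have [lX|] := boolP (l \in X); last by left; exists l, pl.
have lp : l \in p by rewrite (perm_mem ppl) mem_head.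
have [k [pk [ppk ck kl]]] := conn_noncut e_sym up cp (@conn1 _ e l) isT (sub1 _ lp)
  isT p1.
have [kX|] := boolP (k \in X); last by left; exists k, pk.
have kp : k \in p by rewrite (perm_mem ppk) mem_head.
rewrite inE in kl.
have [q [pq lq uq sq]] := conn_upath cp lp kp.
have [ltq|geq] := ltnP (size (l :: q)) (size p); last first.
  have [_ eqm] := uniq_min_size uq sq geq.
  right; exists l, q; rewrite lq eq_sym kl; split=> //.
  by rewrite perm_sym uniq_perm.
have [m [pm [ppm cm mq]]] := conn_noncut e_sym up cp (conn_path e_sym pq) uq sq isT
  ltq.
left; exists m, pm; split=> //; apply/negP => mX.
have : uniq [:: m; l; k].
  rewrite /= !inE negb_or (eq_sym l) kl !andbT; apply/andP; split.
    by apply: contraNneq mq => ->; rewrite mem_head.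
  by apply: contraNneq mq => ->; rewrite -lq mem_last.
move/uniq_leq_size => /(_ X); suff h : {subset [:: m; l; k] <= X} by move/(_ h);
  rewrite /= leqNgt ltnS X2.
by move=> a; rewrite !inE => /or3P[]/eqP->.
Qed.

Local Open Scope ring_scope.
Variables (R : realFieldType) (x y z : R).
Hypotheses (x_ge0 : 0 <= x) (x_le : x <= 9 / 35) (y_ge : 64 / 59 <= y).
Hypotheses (z_ge0 : 0 <= z) (z_le : z <= 3 / 8) (z2_ge : 1 / 8 <= z ^+ 2).

Local Notation W X p := (weight e x (ends X) p).
Let x_le1 : x <= 1. Proof. by move: x_le => ?; lra. Qed.

Lemma weight_perm P p p' : perm_eq p p' -> weight e x P p = weight e x P p'.
Proof. by move=> pp; apply: perm_big; apply: perm_permutations. Qed.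

Lemma ler_weight (P Q : pred (seq V)) p : (forall s, perm_eq s p -> P s -> Q s) ->
  weight e x P p <= weight e x Q p.
Proof.
move=> PQ; rewrite !weight_mkcond; apply: ler_sum_permutations => s /PQ.
by case: (P s) => [/(_ isT) ->//|_]; case: (Q s); rewrite ?exprn_ge0.
Qed.

Lemma weight_ends3 X p : uniq X -> {subset X <= p} -> (2 < size X)%N -> W X p = 0.
Proof.
move=> uX Xp X3; rewrite weight_mkcond big_seq big1 // => s.
rewrite mem_permutations => ps; case: ifP => // /allP eX.
have Xs a : a \in X -> a \in s by move=> /Xp; rewrite (perm_mem ps).
have : {in X &, injective (index^~ s)}.
  by move=> a b /Xs as_ /Xs bs eqi; rewrite -(nth_index a as_) eqi nth_index.
move/map_inj_in_uniq => uiX; move: uX; rewrite -uiX => /uniq_leq_size.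
move=> /(_ [:: 0%N; (size s).-1]); rewrite size_map /=.
suff h : {subset [seq index a s | a <- X] <= [:: 0%N; (size s).-1]}.
  by move=> /(_ h); move: X3; clear; lia.
move=> i /mapP[a aX ->]; rewrite !inE.
by case/orP: (eX a aX) => /eqP h; rewrite ?h ?eqxx // -h eqxx orbT.
Qed.

Lemma weight_le_pow2 X p : uniq p -> conn e p -> (0 < size p)%N ->
  W X p <= 2 ^+ (size p).-1.
Proof.
move=> up cp p0; apply: (@le_trans _ _ (W [::] p)); first exact: ler_weight.
have [n] := ubnP (size p); elim: n p up cp p0 => // n IH p up cp p0 szp.
have [p1|p1] := ltnP 1 (size p); last first.
  case: p up cp p0 szp p1 => // v [|//] _ _ _ _ _.
  by rewrite /weight /permutations /= big_cons big_nil addr0 expr0 expr0.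
have [v vp] : exists v, v \in p by case: p p1 {up cp p0 szp} => // v p _; exists v;
  apply: mem_head.
have sv : {subset [:: v] <= p} by move=> a; rewrite inE => /eqP->.
have [l [p' [pp cp' _]]] := conn_noncut e_sym up cp (@conn1 _ e v) isT sv isT p1.
have ulp : uniq (l :: p') by rewrite -(perm_uniq pp).
have /andP[lp' up'] := ulp.
have sz := perm_size pp; have p'0 : p' != [::] by move: p1; rewrite sz; case: (p').
have [q qp elq] := conn_neighbor (eq_conn (perm_mem pp) cp) lp' p'0.
rewrite (weight_perm _ pp) sz /=.
have := @weight_ends_ins_le2 _ e _ x e_sym x_ge0 x_le1 x_le [::] l q p' ulp cp' qp
  elq isT (fun a => ltac:(done)).
have p'1 : (0 < size p')%N by rewrite lt0n size_eq0.
have szp' : (size p' < n)%N by move: szp; rewrite sz.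
have := IH p' up' cp' p'1 szp' => h1 h2.
apply: le_trans h2 _; rewrite -(prednK p'1) exprS.
by rewrite ler_wpM2l.
Qed.

Theorem weight_ends_le X p : uniq p -> conn e p -> (1 < size p)%N ->
  uniq X -> {subset X <= p} -> (size X <= 3)%N ->
  W X p <= 16 * z ^+ size X * y ^+ size p.
Proof.
have y1 : 1 <= y by move: y_ge => ?; lra.
have y0 : 0 <= y by apply: le_trans y1.
have z1 : z <= 1 by move: z_le => ?; lra.
have [n] := ubnP (size p); elim: n p X => // n IH p X szp up cp p1 uX Xp.
have Yge1 k : 1 <= y ^+ k by rewrite exprn_ege1.
rewrite leq_eqVlt => /orP[/eqP X3 | X2].
  by rewrite weight_ends3 ?X3 // !mulr_ge0 ?exprn_ge0.
have Zge : 1 / 8 <= z ^+ size X.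
  by apply: le_trans z2_ge _; apply: ler_wiXn2l.
have Z0 := exprn_ge0 (size X) z_ge0.
have big (B : R) : B <= 2 * y ^+ size p -> B <= 16 * z ^+ size X * y ^+ size p.
  move=> /le_trans; apply; rewrite ler_wpM2r ?exprn_ge0 //; lra.
have [p2|p2] := leqP (size p) 2.
  apply: big; apply: le_trans (weight_le_pow2 X up cp (ltnW p1)) _.
  have -> : (size p).-1 = 1%N by move: p1 p2; clear; lia.
  by rewrite expr1 ler_peMr.
have [/andP[/eqP X0 p4]|nsmall] := boolP ((X == [::]) && (size p <= 4)%N).
  rewrite X0 /= expr0 mulr1; apply: le_trans (weight_le_pow2 _ up cp (ltnW p1)) _.
  apply: (@le_trans _ _ (2 ^+ 3)).
    by rewrite ler_eXn2l ?ltr1n //; move: p4; clear; lia.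
  by have := Yge1 (size p); move: (y ^+ _) => Y; lra.
have [[l [p' [pp cp' lX]]] | [v [p' [pv pp vX LX vL]]]] := noncut_or_path up cp p1
  X2.
  have ulp : uniq (l :: p') by rewrite -(perm_uniq pp).
  have /andP[lp' up'] := ulp; have sz := perm_size pp.
  have p'1 : (1 < size p')%N by move: p2; rewrite sz.
  have p'0 : p' != [::] by case: (p') p'1.
  have [q qp elq] := conn_neighbor (eq_conn (perm_mem pp) cp) lp' p'0.
  have Xp' : {subset X <= p'}.
    move=> a aX; have := Xp _ aX; rewrite (perm_mem pp) in_cons => /orP[/eqP al|//].
    by rewrite -al aX in lX.
  have szp' : (size p' < n)%N by move: szp; rewrite sz.
  have IHX := IH p' X szp' up' cp' p'1 uX Xp' (ltnW X2).
  have Yp' := Yge1 (size p').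
  have yY : 64 / 59 * y ^+ size p' <= y * y ^+ size p' by rewrite ler_wpM2r //
    exprn_ge0.
  have ZY : 0 <= z ^+ size X * y ^+ size p' by rewrite mulr_ge0 ?exprn_ge0.
  have ZyY : 64 / 59 * (z ^+ size X * y ^+ size p') <= z ^+ size X * (y * y ^+ size
    p').
    by rewrite mulrCA ler_wpM2l.
  rewrite (weight_perm _ pp) sz /= exprS -mulrA.
  move: IHX; rewrite -mulrA => IHX.
  have [qX|qX] := boolP (q \in X).
    apply: le_trans (weight_ends_fixed e_sym x_ge0 x_le1 x_le ulp cp' qp elq lX Xp'
      qX p'1) _.
    by lra.
  have X0 : X = [::] -> (3 < size p')%N.
    by move=> X0; move: nsmall; rewrite X0 eqxx sz -ltnNge.
  apply: le_trans (weight_ends_free e_sym x_ge0 x_le1 x_le ulp cp' qp elq lX Xp' uX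
    qX p'1 X0) _.
  have uqX : uniq (q :: X) by rewrite /= qX.
  have qXp : {subset q :: X <= p'} by move=> a;
    rewrite in_cons => /orP[/eqP->|/Xp'].
  have := IH p' (q :: X) szp' up' cp' p'1 uqX qXp X2; rewrite /= exprS.
  have : z * (z ^+ size X * y ^+ size p') <= 3 / 8 * (z ^+ size X * y ^+ size p').
    by rewrite ler_wpM2r.
  rewrite -!mulrA; move: IHX ZY ZyY.
  move: (z ^+ _ * y ^+ _) (z ^+ _ * (y * _)) => A B; move: (z * A) => C; lra.
set L := last v p' in LX vL.
have up' : uniq (v :: p') by rewrite -(perm_uniq pp).
have sz := perm_size pp.
apply: big; apply: (@le_trans _ _ (2 * y ^+ size p')); last first.
  by rewrite ler_wpM2l // sz; apply: ler_weXn2l => //; apply: leqnSn.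
have rp : path e L (rev (belast v p')).
  by rewrite rev_path; apply: sub_path pv => a b; rewrite e_sym.
have perm_r : perm_eq p (L :: rev (belast v p')).
  rewrite (perm_trans pp) // lastI -/L perm_rcons perm_cons perm_sym.
  by rewrite perm_rev.
have lr : last L (rev (belast v p')) = v.
  case: (p') sz p1 => [|w r _ _]; first by move=> ->.
  by rewrite /= rev_cons last_rcons.
have xl := x_le; have yg := y_ge.
have [h1 _] := path_weights e_sym x_ge0 x_le1 xl yg pv up'.
have ur : uniq (L :: rev (belast v p')) by rewrite -(perm_uniq perm_r).
have [h2 _] := path_weights e_sym x_ge0 x_le1 xl yg rp ur.
rewrite size_rev size_belast in h2.
rewrite /path_fixed -(weight_perm _ pp) -/L in h1.
rewrite /path_fixed -(weight_perm _ perm_r) lr in h2.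
rewrite mulr_natl mulr2n; apply: le_trans (lerD h1 h2).
rewrite !weight_mkcond -big_split /=; apply: ler_sum_permutations => s ps.
case: ifP => [/allP eX|_]; last by rewrite addr_ge0 //; case: ifP;
  rewrite ?exprn_ge0.
have vs : v \in s by rewrite (perm_mem ps) (perm_mem pp) mem_head.
have Ls : L \in s by rewrite (perm_mem ps) (perm_mem pp) mem_last.
have ne : index v s != index L s.
  by apply: contraNneq vL => eqi; rewrite -(nth_index v vs) eqi nth_index.
have E0 := exprn_ge0 (net e s) x_ge0.
have := eX _ vX; have := eX _ LX.
case fv: (first_at v s); case lv: (last_at v s); case fL: (first_at L s);
  case lL: (last_at L s);
  rewrite //= ?lerDl ?lerDr ?addr0 ?add0r ?ler_wpDr //.
- by move=> _ _; case/eqP: ne; rewrite (eqP fv) (eqP fL).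
- by move=> _ _; case/eqP: ne; apply: succn_inj; rewrite (eqP lv) (eqP lL).
Qed.

End Bound.

(** * Permutations as arrangements *)

Lemma reach_sum (V : eqType) (e : rel V) w s d : uniq s ->
  reach e w s d = \sum_(v <- s | e w v) (d + index v s).
Proof.
elim: s d => [|a s IH] d /=; first by rewrite big_nil.
case/andP=> as_ us; rewrite IH // big_cons /= eqxx addn0.
have -> : \sum_(v <- s | e w v) (d + index v (a :: s)) = \sum_(v <- s | e w v)
  (d.+1 + index v s).
  rewrite big_seq_cond [RHS]big_seq_cond; apply: eq_bigr => v /andP[vs _] /=.
  by rewrite (_ : a == v = false) ?addnS //; apply: contraNF as_ => /eqP->.
by case: (e w a); rewrite ?mul1n.
Qed.

Lemma net_sum (V : eqType) (e : rel V) s : uniq s ->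
  net e s = \sum_(u <- s) \sum_(v <- s | (index u s < index v s) && e u v)
              (index v s - index u s - 1).
Proof.
elim: s => [|a s IH] /=; first by rewrite big_nil.
case/andP=> as_ us; rewrite IH // big_cons /= eqxx big_cons /= eqxx /= reach_sum //.
have idx v : v \in s -> index v (a :: s) = (index v s).+1.
  by move=> vs /=; rewrite (_ : a == v = false) //; apply: contraNF as_ => /eqP->.
congr (_ + _).
  rewrite big_seq_cond [RHS]big_seq_cond; apply: eq_big => [v|v /andP[vs _]].
    by case vs: (v \in s) => //=; have /= -> := idx v vs.
  by have /= -> := idx v vs; rewrite subn0 subn1.
rewrite big_seq [RHS]big_seq; apply: eq_bigr => u us'; rewrite big_cons /= eqxx /=.
have /= -> := idx u us'; rewrite /=.
rewrite big_seq_cond [RHS]big_seq_cond; apply: eq_big => [v|v /andP[vs _]].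
  by case vs: (v \in s) => //=; have /= -> := idx v vs.
by have /= -> := idx v vs; rewrite subSS.
Qed.

Section Trees.
Variables (n : nat) (T : graph n).
Implicit Type alpha : 'S_n.

Definition arrangement alpha : seq 'I_n := [seq (alpha^-1)%g j | j <- enum 'I_n].

Lemma index_arrangement alpha u : index u (arrangement alpha) = alpha u.
Proof.
rewrite /arrangement -{1}(permK alpha u) index_map; last exact: perm_inj.
by rewrite index_enum_ord.
Qed.

Lemma perm_arrangement alpha : perm_eq (arrangement alpha) (enum 'I_n).
Proof.
apply: uniq_perm; [| exact: enum_uniq |].
  by rewrite map_inj_uniq ?enum_uniq //; apply: perm_inj.
move=> u; rewrite mem_enum; apply/mapP.
by exists (alpha u); rewrite ?mem_enum ?permK.
Qed.

Lemma arrangement_inj : injective arrangement.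
Proof.
move=> a b eqab; apply/permP => u; apply: ord_inj.
by rewrite -!index_arrangement eqab.
Qed.

Lemma net_arrangement alpha : symmetric (adj T) ->
  net (adj T) (arrangement alpha) = net_cost T alpha.
Proof.
move=> sT; rewrite net_sum; last by rewrite (perm_uniq (perm_arrangement alpha))
  enum_uniq.
rewrite (perm_big _ (perm_arrangement alpha)) big_enum /=.
under eq_bigr => u _ do rewrite (perm_big _ (perm_arrangement alpha)) big_enum_cond
  /=.
pose g (u v : 'I_n) := if adj T u v then (`|pos alpha u - pos alpha v|%N - 1) else
  0.
have gC u v : g u v = g v u by rewrite /g sT distnC.
have gE u v : adj T u v -> alpha u < alpha v -> alpha v - alpha u - 1 = g u v.
  by move=> euv uv; rewrite /g euv /pos; lia.
transitivity (\sum_(u < n) \sum_(v < n | alpha u < alpha v) g u v).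
  apply: eq_bigr => u _; rewrite [RHS]big_mkcond [LHS]big_mkcond;
    apply: eq_bigr => v _.
  rewrite !index_arrangement; case: ltnP => //= uv; rewrite /g;
    case: ifP => //= euv.
  by rewrite gE // /g euv.
transitivity (\sum_(u < n) \sum_(v < n | u < v) g u v); last first.
  by apply: eq_bigr => u _; rewrite big_mkcondr.
have neq (u v : 'I_n) : u != v -> (alpha u : nat) <> alpha v.
  by move=> uv /ord_inj /perm_inj /eqP; rewrite (negPf uv).
transitivity (\sum_(u < n) \sum_(v < n) ((alpha u < alpha v) && (u < v)) * g u v +
              \sum_(u < n) \sum_(v < n) ((alpha u < alpha v) && (v < u)) * g u v).
  rewrite -big_split; apply: eq_bigr => u _; rewrite -big_split big_mkcond /=.
  apply: eq_bigr => v _; case: ltnP => //= uv.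
  by case: (ltngtP u v) => [||/ord_inj eq_uv]; rewrite ?mul1n ?addn0 //;
    rewrite eq_uv ltnn in uv.
rewrite [X in _ + X]exchange_big -big_split; apply: eq_bigr => u _ /=.
rewrite -big_split [RHS]big_mkcond /=; apply: eq_bigr => v _; rewrite (gC v u).
case: (ltnP u v) => [uv|_]; last by rewrite !andbF.
rewrite !andbT; have: u != v by rewrite -val_eqE /= ltn_eqF.
by move/neq; case: ltngtP => // _ _; rewrite ?mul1n ?addn0.
Qed.

Lemma card_OLAplus (R : realFieldType) (x : R) k (X : {set 'I_n}) :
  symmetric (adj T) -> (0 <= x)%R -> (x <= 1)%R ->
  (x ^+ k * #|OLAplus T k X|%:R <= weight (adj T) x (ends (enum X)) (enum 'I_n))%R.
Proof.
move=> sT x0 x1; rewrite -sum1_card natr_sum mulr_sumr.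
set O := OLAplus T k X; pose arrs := [seq arrangement a | a <- enum O].
have arrO s : s \in arrs -> [/\ perm_eq s (enum 'I_n), ends (enum X) s & net (adj
  T) s <= k].
  case/mapP=> a; rewrite mem_enum inE => /andP[ck /forall_inP eX] ->.
  split; rewrite ?net_arrangement ?perm_arrangement //; apply/allP => u.
  rewrite mem_enum => /eX; rewrite /first_at /last_at index_arrangement /pos.
  by rewrite size_map size_enum_ord eqSS.
apply: (@le_trans _ _ (\sum_(s <- arrs) x ^+ net (adj T) s)%R).
  rewrite big_map big_enum /=; apply: ler_sum => a aO; rewrite mulr1.
  have [|_ _ le_k] := arrO (arrangement a); first by rewrite map_f ?mem_enum.
  exact: ler_wiXn2l.
have uarrs : uniq arrs by rewrite (map_inj_uniq (@arrangement_inj)) enum_uniq.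
rewrite /weight -[leRHS]big_filter; set E := filter _ _.
have uE : uniq E by rewrite filter_uniq ?permutations_uniq.
have pE : perm_eq E (arrs ++ filter [predC arrs] E).
  apply: uniq_perm => // [|s].
    rewrite cat_uniq uarrs filter_uniq ?andbT //=; apply/hasPn => s.
    by rewrite mem_filter => /andP[].
  rewrite mem_cat [s \in filter _ E]mem_filter inE.
  have [sa|//] := boolP (s \in arrs).
  by have [ps es _] := arrO s sa; rewrite /E mem_filter es mem_permutations.
rewrite (perm_big _ pE) big_cat /= lerDl; apply: sumr_ge0 => s _.
exact: exprn_ge0.
Qed.

Lemma tree_conn : is_tree T -> conn (adj T) (enum 'I_n).
Proof.
case=> _ sT cT _ B [u _ Bu] [v _ nBv]; apply: contrapT => h.
have clB : closed (adj T) B.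
  have sub a b : adj T a b -> B a -> B b.
    move=> eab Ba; apply/negPn/negP => nBb; apply: h.
    by exists a, b; rewrite !mem_enum.
  move=> a b eab; apply/idP/idP; first exact: sub.
  by apply: sub; rewrite sT.
by move: nBv; rewrite -[B v]/(v \in B) -(closed_connect clB (cT u v)) [_ \in _]Bu.
Qed.

End Trees.

Section Constants.
Local Open Scope ring_scope.
Variable R : realType.

Lemma powR2_exp (a : R) k : (2 `^ a) ^+ k = 2 `^ (a * k%:R).
Proof. by rewrite -powR_mulrn ?powR_ge0 // powRrM. Qed.

Lemma powR2N_nat k : 2 `^ (- k%:R) = (2 ^+ k)^-1 :> R.
Proof. by rewrite powRN powR_mulrn. Qed.

Lemma powR2_le (a b : R) : a <= b -> 2 `^ a <= 2 `^ b.
Proof. by apply: ler_powR; rewrite ler1n. Qed.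

Lemma powR2_x_le : 2 `^ (- (196 / 100)) <= 9 / 35 :> R.
Proof.
rewrite -(@ler_pXn2r _ 25) ?nnegrE ?powR_ge0 //; last by lra.
rewrite powR2_exp (_ : _ * _ = - 49%:R); last by lra.
rewrite powR2N_nat expr_div_n ler_pdivlMr ?exprn_gt0 // mulrC ler_pdivrMr
  ?exprn_gt0 //.
by rewrite -!natrX -natrM ler_nat; lia.
Qed.

Lemma powR2_y_ge : 64 / 59 <= 2 `^ (119 / 1000) :> R.
Proof.
apply: (@le_trans _ _ (2 `^ (2 / 17))); last by apply: powR2_le; lra.
rewrite -(@ler_pXn2r _ 17) ?nnegrE ?powR_ge0 //; last by lra.
rewrite powR2_exp (_ : 2 / 17 * _ = 2%:R); last by lra.
rewrite powR_mulrn // expr_div_n ler_pdivrMr ?exprn_gt0 //.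
by rewrite -!natrX -natrM ler_nat; lia.
Qed.

Lemma powR2_z_le : 2 `^ (- (117 / 80)) <= 3 / 8 :> R.
Proof.
apply: (@le_trans _ _ (2 `^ (- (10 / 7)))); first by apply: powR2_le; lra.
rewrite -(@ler_pXn2r _ 7) ?nnegrE ?powR_ge0 //; last by lra.
rewrite powR2_exp (_ : _ * _ = - 10%:R); last by lra.
rewrite powR2N_nat expr_div_n ler_pdivlMr ?exprn_gt0 // mulrC ler_pdivrMr
  ?exprn_gt0 //.
by rewrite -!natrX -natrM ler_nat; lia.
Qed.

Lemma powR2_z2_ge : 1 / 8 <= (2 `^ (- (117 / 80))) ^+ 2 :> R.
Proof.
rewrite powR2_exp; apply: (@le_trans _ _ (2 `^ (- 3%:R))); last by apply: powR2_le;
  lra.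
by rewrite powR2N_nat -natrX; lra.
Qed.

Lemma powR2_split (n k i : nat) :
  16 * (2 `^ (- (117 / 80))) ^+ i * (2 `^ (119 / 1000)) ^+ n
  = (2 `^ (- (196 / 100))) ^+ k *
    2 `^ (119 / 1000 * n%:R + 196 / 100 * k%:R - 117 / 80 * i%:R + 4) :> R.
Proof.
have powR2D (a b : R) : 2 `^ (a + b) = 2 `^ a * 2 `^ b.
  by rewrite powRD // pnatr_eq0 implybT.
have -> : 16 = 2 `^ 4%:R :> R by rewrite powR_mulrn // -natrX.
by rewrite !powR2_exp -!powR2D; congr (2 `^ _); lra.
Qed.

End Constants.

Local Open Scope ring_scope.

(* 117 / 80 = 1.4625 *)
Theorem theorem3p4 (R : realType) (n k i : nat) (hn : (2 <= n)%N)
    (hi : (i <= 3)%N) :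
  ((t n k i)%:R : R) <=
    2 `^ (119 / 1000 * n%:R + 196 / 100 * k%:R - 117 / 80 * i%:R + 4).
Proof.
set B := 2 `^ _; have B0 : 0 <= B by apply: powR_ge0.
suff bound (T : graph n) (X : {set 'I_n}) : is_tree T -> #|X| = i -> #|OLAplus T k
  X|%:R <= B.
  rewrite /t; elim/big_ind: _ => // [a b ha hb|T /asboolP treeT].
    by rewrite /maxn; case: ifP.
  elim/big_ind: _ => // [a b ha hb|X /eqP cX]; first by rewrite /maxn; case: ifP.
  exact: bound.
move=> treeT cX; have [_ sT _ _] := treeT.
set x : R := 2 `^ (- (196 / 100)); have x_gt0 : 0 < x by apply: powR_gt0.
have x_le : x <= 9 / 35 := powR2_x_le R.
have x_le1 : x <= 1 by lra.
have szX : size (enum X) = i by rewrite -cardE.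
have szn : size (enum 'I_n) = n by rewrite size_enum_ord.
have hX : {subset enum X <= enum 'I_n} by move=> u _; rewrite mem_enum.
rewrite -(ler_pM2l (exprn_gt0 k x_gt0)).
apply: le_trans (card_OLAplus k X sT (ltW x_gt0) x_le1) _.
rewrite -powR2_split -[I in _ * _ ^+ I * _]szX -[N in _ * _ * _ ^+ N]szn.
apply: weight_ends_le; rewrite ?enum_uniq ?szn ?szX ?powR_ge0 ?powR2_y_ge
  ?powR2_z_le ?powR2_z2_ge //.
exact: tree_conn.
Qed.
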